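(* Let $(\Omega,\Sigma,\mu)$ be a measure space with $\mu:\Sigma\to[0,\infty]$ a locally determined positive measure, let $X$ be a Banach space over $\mathbb{K}$ ($\mathbb{R}$ or $\mathbb{C}$), and let $F:\Omega\to X$ be weakly $\mu$-measurable. Then $F$ is Pettis integrable if and only if $F$ is locally Pettis integrable and the vector measure $\nu_F:\Sigma^f\to X$, $\nu_F(B)=\mathbb{P}\text{-}\int_BF\,d\mu$, is strongly additive.
   Context: $\Omega$ is a nonempty set, $\Sigma$ a $\sigma$-algebra on $\Omega$, $\Sigma^f=\{B\in\Sigma:\mu(B)<\infty\}$, a $\delta$-ring (a ring closed under countable intersections). $\mu$ is semi-finite if every $A\in\Sigma$ with $\mu(A)>0$ contains $B\in\Sigma^f$ with $\mu(B)>0$; $\mu$ is locally determined if it is semi-finite and $\Sigma=\{A\subset\Omega: A\cap B\in\Sigma\ \forall B\in\Sigma^f\}$. A function with values in a Banach space is strongly $\mu$-measurable if it is the pointwise $\mu$-a.e. limit of a sequence of simple ($\Sigma$-measurable, finitely valued) functions whose supports have finite $\mu$-measure. $F:\Omega\to X$ is weakly $\mu$-measurable if $\langle F,x^*\rangle$ is strongly $\mu$-measurable for every $x^*\in X^*$ (the dual of $X$). Functions that agree $\mu$-a.e. with $\Sigma$-measurable ones are integrated in the obvious way. A weakly $\mu$-measurable $F$ is Pettis integrable, $F\in\mathbb{P}(\mu,X)$, if $\langle F,x^*\rangle\in L^1(\mu)$ for all $x^*\in X^*$ and for each $A\in\Sigma$ there is $x_A\in X$ with $\int_A\langle F,x^*\rangle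 d\mu=\langle x_A,x^*\rangle$ for all $x^*\in X^*$; $x_A=:\mathbb{P}\text{-}\int_AF\,d\mu$. $F$ is locally Pettis integrable if it is weakly $\mu$-measurable and $\chi_BF\in\mathbb{P}(\mu,X)$ for all $B\in\Sigma^f$; then for $B\in\Sigma^f$, $\mathbb{P}\text{-}\int_BF\,d\mu:=\mathbb{P}\text{-}\int_B\chi_BF\,d\mu$. Functions $F,G:\Omega\to X$ are identified when weakly equal $\mu$-a.e., i.e. $\langle F,x^*\rangle=\langle G,x^*\rangle$ $\mu$-a.e. for each $x^*\in X^*$. A vector measure $\nu:\Sigma^f\to X$ (a set function countably additive on disjoint sequences of $\Sigma^f$ whose union lies in $\Sigma^f$) is strongly additive if $\nu(B_n)\to0$ in norm for every pairwise disjoint sequence $\{B_n\}\subset\Sigma^f$. *)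

(* Defs.v *)
From HB Require Import structures.
From mathcomp Require Import all_boot all_order all_algebra.
From mathcomp Require Import complex.
From mathcomp Require Import all_classical all_reals all_analysis.

Set Implicit Arguments.
Unset Strict Implicit.
Unset Printing Implicit Defensive.

Import Order.TTheory GRing.Theory Num.Theory.
Import numFieldNormedType.Exports.

Local Open Scope classical_set_scope.
Local Open Scope ring_scope.

Variant RorC := RealScalars | ComplexScalars.

Definition scalar_field (R : realType) (k : RorC) : numFieldType :=
  match k with RealScalars => R | ComplexScalars => R[i] end.

Definition scalar_re (R : realType) (k : RorC) : scalar_field R k -> R :=
  match k with RealScalars => fun z => z | ComplexScalars => @complex.Re R end.

Definition scalar_im (R : realType) (k : RorC) : scalar_field R k -> R :=
  match k with RealScalars => fun=> 0 | ComplexScalars => @complex.Im R end.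

Section MeasureSpace.
Context (R : realType) (d : measure_display) (T : measurableType d).
Variable mu : {measure set T -> \bar R}.

Definition finite_meas (B : set T) : Prop :=
  measurable B /\ (mu B < +oo)%E.

Definition semi_finite : Prop :=
  forall A, measurable A -> (0 < mu A)%E ->
    exists B, [/\ B `<=` A, finite_meas B & (0 < mu B)%E].

Definition locally_determined : Prop :=
  semi_finite /\
  forall A : set T,
    measurable A <-> (forall B, finite_meas B -> measurable (A `&` B)).

Variable k : RorC.
Local Notation K := (scalar_field R k).

Definition simple_finite_support (Y : normedModType K) (s : T -> Y) : Prop :=
  [/\ finite_set (range s),
      forall y, measurable (s @^-1` [set y]) &
      (mu [set t | s t != 0%R] < +oo)%E].

Definition strongly_measurable (Y : normedModType K) (f : T -> Y) : Prop :=
  exists2 s : nat -> T -> Y,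
    forall n, simple_finite_support (s n) &
    {ae mu, forall t, s n t @[n --> \oo] --> f t}.

(* Library integrability includes measurability; for scalar-valued g it is
   required of the real and imaginary parts, which for R[i] is Borel
   measurability of g together with integrability of its modulus. *)
Definition integrable_scalar (g : T -> K) : Prop :=
  mu.-integrable setT (EFin \o (@scalar_re R k \o g)) /\
  mu.-integrable setT (EFin \o (@scalar_im R k \o g)).

(* f itself need not be measurable, only a.e. equal to a measurable function. *)
Definition in_L1 (f : T -> K) : Prop :=
  exists2 g : T -> K, integrable_scalar g & {ae mu, forall t, f t = g t}.

Definition has_integral (A : set T) (f : T -> K) (c : K) : Prop :=
  exists g : T -> K,
    [/\ integrable_scalar g, {ae mu, forall t, f t = g t},
        scalar_re c = \int[mu]_(t in A) scalar_re (g t) &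
        scalar_im c = \int[mu]_(t in A) scalar_im (g t)].

Variable X : completeNormedModType K.

Definition weakly_measurable (F : T -> X) : Prop :=
  forall x' : {linear X -> K^o}, continuous x' ->
    strongly_measurable (fun t => x' (F t)).

Definition is_pettis_integral (A : set T) (F : T -> X) (x : X) : Prop :=
  forall x' : {linear X -> K^o}, continuous x' ->
    has_integral A (fun t => x' (F t)) (x' x).

Definition pettis_integrable (F : T -> X) : Prop :=
  [/\ weakly_measurable F,
      forall x' : {linear X -> K^o}, continuous x' -> in_L1 (fun t => x' (F t)) &
      forall A, measurable A -> exists x, is_pettis_integral A F x].

(* The Pettis integral is unique by Hahn-Banach; 0 is a junk value, taken when
   there is none. *)
Definition pettis_integral (A : set T) (F : T -> X) : X :=
  xget 0 [set x | is_pettis_integral A F x].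

Definition chi_mul (B : set T) (F : T -> X) : T -> X :=
  fun t => (\1_B t : K) *: F t.

Definition locally_pettis (F : T -> X) : Prop :=
  weakly_measurable F /\
  forall B, finite_meas B -> pettis_integrable (chi_mul B F).

Definition pettis_measure (F : T -> X) (B : set T) : X :=
  pettis_integral B (chi_mul B F).

(* Set functions on the sets of finite measure are total functions on [set T];
   their values elsewhere are never used. *)
Definition vector_measure (m : set T -> X) : Prop :=
  forall B : nat -> set T,
    (forall n, finite_meas (B n)) -> trivIset setT B ->
    finite_meas (\bigcup_n B n) ->
    \sum_(0 <= i < n) m (B i) @[n --> \oo] --> m (\bigcup_n B n).

Definition strongly_additive (m : set T -> X) : Prop :=
  forall B : nat -> set T,
    (forall n, finite_meas (B n)) -> trivIset setT B ->
    m (B n) @[n --> \oo] --> (0 : X).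

End MeasureSpace.

(* Main.v *)
From HB Require Import structures.
Require Import Defs.
From mathcomp Require Import all_boot all_order all_algebra complex.
From mathcomp Require Import all_classical all_reals all_analysis.
From mathcomp Require Import measurable_realfun lra ring.

Set Implicit Arguments.
Unset Strict Implicit.
Unset Printing Implicit Defensive.

Import Order.TTheory GRing.Theory Num.Theory.
Import numFieldNormedType.Exports.

Local Open Scope classical_set_scope.
Local Open Scope ring_scope.

(** The theorem combines two facts about the set function
  [nu] that maps [B] to the Pettis integral of [F] over [B].

  The Orlicz-Pettis theorem: a weakly countably additive set function is
  countably additive in norm. Scalar integrals are countably additive, so
  this makes [nu] a vector measure when [F] is locally Pettis integrable
  ([locally_pettis_vector_measure]) and strongly additive when [F] is Pettis
  integrable ([pettis_integrable_strongly_additive]); in the second case the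
  union of the disjoint sets may have infinite measure, which is harmless
  because [F] has an integral over it. The theorem [orlicz_pettis] is proved
  for families of vectors indexed by sets of naturals, by a Baire category
  argument on the Cantor space of these sets. Its two uses of duality, that a
  vector is normed by a functional and that a vector which is not in the
  closure of a subspace is separated from it, come from [hahn_banach]. All
  this is done over the reals; a complex Banach space enters through its
  underlying real space, and real functionals are turned into complex ones by
  [complexify].

  Conversely, strong additivity means that [nu] is concentrated on sets of
  finite measure: for each positive [e] there is a set [B] of finite measure
  such that [nu C] has norm at most [e] for all [C] of finite measure outside
  [B] ([strongly_additive_exhaustion]). Each scalar function [x' \o F] vanishes
  almost everywhere outside a countable union of sets of finite measure. On
  [B] it is integrable, and outside [B] its integrals over sets of finite
  measure are bounded, so it is integrable ([integrable_of_tail]). With sets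
  [G n] of finite measure that exhaust [nu] up to [1 / (n + 1)], the sequence
  [nu (A `&` G n)] is Cauchy, and its limit is the Pettis integral of [F] over
  [A]: by enlarging [G n] with the sets that carry [x' \o F], which changes
  [nu] by at most [1 / (n + 1)], the scalar integral over [A] is reached in the
  limit. *)

(** * The Hahn-Banach theorem for sublinear functionals *)

Section HahnBanach.
Context (R : realType) (V : lmodType R).
Implicit Types p q f : V -> R.

Definition sublinear p :=
  (forall x y, p (x + y) <= p x + p y) /\
  (forall a x, 0 <= a -> p (a *: x) = a * p x).

Lemma sublinear0 p : sublinear p -> p 0 = 0.
Proof. by case=> _ h; rewrite -(scale0r (0 : V)) h// mul0r. Qed.

Lemma sublinear_geN p x : sublinear p -> - p (- x) <= p x.
Proof.
move=> ph; have := ph.1 x (- x); rewrite subrr sublinear0//; lra.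
Qed.

(** Homogeneity only has to be checked as an inequality, since the converse
  inequality at [a] is the same one at the inverse of [a]. This is applied to
  infima, for which only upper bounds are immediate. *)
Lemma sublinear_le p : p 0 = 0 -> (forall x y, p (x + y) <= p x + p y) ->
  (forall a x, 0 < a -> p (a *: x) <= a * p x) -> sublinear p.
Proof.
move=> p0 pD pZ; split=> // a x.
rewrite le_eqVlt => /orP[/eqP <-|a0]; first by rewrite scale0r mul0r.
apply/eqP; rewrite eq_le pZ//= -ler_pdivlMl//.
have ai : 0 < a^-1 by rewrite invr_gt0.
by apply: le_trans (pZ _ _ ai); rewrite scalerA mulVf ?gt_eqF// scale1r.
Qed.

(** The lower bound for a chain in the application of Zorn's lemma. *)
Lemma sublinear_inf p (A : set (V -> R)) : sublinear p -> A !=set0 ->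
  (forall q, A q -> sublinear q /\ forall x, q x <= p x) ->
  (forall q1 q2, A q1 -> A q2 -> forall x y, exists2 q, A q &
     q (x + y) <= q1 x + q2 y) ->
  let m := fun x => inf [set q x | q in A] in
  sublinear m /\ forall q, A q -> forall x, m x <= q x.
Proof.
move=> ph [q0 Aq0] Ap Adir m.
have lbA x : lbound [set q x | q in A] (- p (- x)).
  move=> _ [q Aq <-]; have [qh qp] := Ap q Aq.
  by rewrite (le_trans _ (sublinear_geN x qh))// lerN2.
have neA x : [set q x | q in A] !=set0 by exists (q0 x), q0.
have mle q : A q -> forall x, m x <= q x.
  by move=> Aq x; apply: ge_inf; [exists (- p (- x))|exists q].
split=> //; apply: sublinear_le => [|x y|a x a0].
- apply/eqP; rewrite eq_le; apply/andP; split.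
    by rewrite (le_trans (mle _ Aq0 _))// sublinear0//; case: (Ap _ Aq0).
  apply: lb_le_inf => // _ [q Aq <-].
  by rewrite sublinear0//; case: (Ap _ Aq).
- rewrite -lerBlDl; apply: lb_le_inf => // _ [q2 Aq2 <-].
  rewrite lerBlDl -lerBlDr; apply: lb_le_inf => // _ [q1 Aq1 <-].
  rewrite lerBlDr; have [q Aq] := Adir _ _ Aq1 Aq2 x y.
  exact: le_trans (mle _ Aq _).
- rewrite -ler_pdivrMl//; apply: lb_le_inf => // _ [q Aq <-].
  rewrite ler_pdivrMl//; have [qh _] := Ap _ Aq.
  by rewrite -(qh.2 a x (ltW a0)); exact: mle.
Qed.

(** Any sublinear functional can be lowered until it is at most the linear
  functional of slope [p x0] on the half-line opposite to [x0]. Applied to a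
  minimal functional this says that it is odd, hence linear; applied before
  minimizing, it forces the value at [x0] to survive the minimization. *)
Lemma sublinear_shift p x0 : sublinear p ->
  exists q, [/\ sublinear q, forall x, q x <= p x & q (- x0) <= - p x0].
Proof.
move=> ph.
pose D (y : V) := [set p (y + t *: x0) - t * p x0 | t in [set t : R | 0 <= t]].
pose m y := inf (D y).
have lbm y : lbound (D y) (- p (- y)).
  move=> _ [t /= t0 <-]; rewrite -(ph.2 t x0 t0).
  have := ph.1 (y + t *: x0) (- y); rewrite addrAC subrr add0r; lra.
have mle y (t : R) : 0 <= t -> m y <= p (y + t *: x0) - t * p x0.
  by move=> t0; apply: ge_inf; [exists (- p (- y))|exists t].
have ne y : D y !=set0 by exists (p (y + 0 *: x0) - 0 * p x0), 0 => //=.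
have mp x : m x <= p x.
  by have := mle x 0 (lexx _); rewrite scale0r addr0 mul0r subr0.
exists m; split => //; last first.
  have := mle (- x0) 1 ler01.
  by rewrite scale1r addNr sublinear0// mul1r sub0r.
apply: sublinear_le => [|x y|a x a0].
- apply/eqP; rewrite eq_le; apply/andP; split.
    by rewrite (le_trans (mp _))// sublinear0.
  by apply: lb_le_inf => // y /lbm; rewrite oppr0 sublinear0// oppr0.
- rewrite -lerBlDl; apply: lb_le_inf => // _ [t /= t0 <-].
  rewrite lerBlDl -lerBlDr; apply: lb_le_inf => // _ [s /= s0 <-].
  rewrite lerBlDr; apply: le_trans (mle _ (s + t) _) _; first exact: addr_ge0.
  have := ph.1 (x + s *: x0) (y + t *: x0).
  by rewrite addrACA -scalerDl mulrDl; lra.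
- rewrite -ler_pdivrMl//; apply: lb_le_inf => // _ [t /= t0 <-].
  rewrite ler_pdivrMl// mulrBr -(ph.2 _ _ (ltW a0)) scalerDr scalerA mulrA.
  by apply: mle; rewrite mulr_ge0// ltW.
Qed.

Lemma minimal_sublinear p : sublinear p ->
  exists2 f, sublinear f /\ (forall x, f x <= p x) &
    forall q, sublinear q -> (forall x, q x <= f x) -> q = f.
Proof.
move=> ph.
pose W := {q : V -> R | sublinear q /\ forall x, q x <= p x}.
have [||[q1 q1P] [q2 q2P] h1 h2|A Atot|[f fh] fmin] :=
    @Zorn W (fun q1 q2 : W => `[< forall x : V, (sval q2) x <= (sval q1) x >]).
- by move=> q; exact/asboolP.
- move=> q1 q2 q3 /asboolP h1 /asboolP h2; apply/asboolP => x.
  exact: le_trans (h2 x) (h1 x).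
- move: h1 h2 => /asboolP h1 /asboolP h2.
  apply: eq_exist; apply/funext => x; apply/eqP.
  by rewrite eq_le h1 h2.
- have [->|/set0P[w0 Aw0]] := eqVneq A set0.
    by exists (exist _ p (conj ph (fun x => lexx (p x)))).
  pose B := [set sval w | w in A].
  have [|_ [w _ <-]|_ _ [w1 A1 <-] [w2 A2 <-] x y|mh mle] :=
      sublinear_inf (A := B) ph.
  + by exists (sval w0), w0.
  + exact: (svalP w).
  + have [/asboolW h|/asboolW h] := Atot _ _ A1 A2.
      exists (sval w2); first by exists w2.
      by rewrite (le_trans ((svalP w2).1.1 _ _))// lerD2r h.
    exists (sval w1); first by exists w1.
    by rewrite (le_trans ((svalP w1).1.1 _ _))// lerD2l h.
  + set m := (fun x => _) in mh mle.
    have mp x : m x <= p x.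
      by rewrite (le_trans (mle (sval w0) _ x))//; [exists w0|case: (svalP w0)].
    exists (exist _ m (conj mh mp)) => s As; apply/asboolP => x /=.
    by apply: mle; exists s.
- exists f => // q qh qf.
  have qp x : q x <= p x by apply: le_trans (qf x) _; exact: fh.2.
  by have /(congr1 sval) := fmin (exist _ q (conj qh qp)) (asboolT qf).
Qed.

(** Working with functionals on all of [V] that are only sublinear, instead of
  linear functionals on subspaces, avoids partial functions: a minimal
  sublinear functional is linear. *)
Theorem hahn_banach p x0 : sublinear p ->
  exists f : {linear V -> R^o}, (forall x, f x <= p x) /\ f x0 = p x0.
Proof.
move=> ph; have [q [qh qp q0]] := sublinear_shift x0 ph.
have [f [fh fq] fmin] := minimal_sublinear qh.
have fN x : f (- x) = - f x.
  have [g [gh gf gx]] := sublinear_shift x fh.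
  rewrite (fmin _ gh gf) in gx.
  have := sublinear_geN x fh; lra.
have fD x y : f (x + y) = f x + f y.
  apply/eqP; rewrite eq_le fh.1/=.
  by have := fh.1 (- x) (- y); rewrite -opprD !fN; lra.
have fZ a x : f (a *: x) = a * f x.
  have [a0|a0] := lerP 0 a; first exact: fh.2.
  by rewrite -[a]opprK scaleNr fN fh.2 ?mulNr// oppr_ge0 ltW.
have fl : linear (f : V -> R^o) by move=> a x y; rewrite fD fZ.
pose F : {linear V -> R^o} :=
  HB.pack (f : V -> R^o) (GRing.isLinear.Build R V R^o *:%R f fl).
exists F; split=> [x|]; first exact: le_trans (fq x) (qp x).
apply/eqP; rewrite eq_le (le_trans (fq _) (qp _))/=.
by have /le_trans/(_ q0) := fq (- x0); rewrite fN lerN2.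
Qed.

End HahnBanach.

(** * The Orlicz-Pettis theorem *)

Section OrliczPettis.
Context (R : realType) (V : lmodType R).
Variable N : V -> R.
Hypothesis ND : forall x y, N (x + y) <= N x + N y.
Hypothesis NZ : forall a x, N (a *: x) = `|a| * N x.

Lemma seminorm_sublinear : sublinear N.
Proof. by split=> // a x a0; rewrite NZ ger0_norm. Qed.

Lemma seminorm0 : N 0 = 0.
Proof. exact: sublinear0 seminorm_sublinear. Qed.

Lemma seminorm_ge0 x : 0 <= N x.
Proof.
have := ND x (- x); rewrite subrr seminorm0 -scaleN1r NZ normrN1 mul1r; lra.
Qed.

Lemma seminormB x y : N (x - y) <= N x + N y.
Proof. by rewrite (le_trans (ND _ _))// -scaleN1r NZ normrN1 mul1r. Qed.

Definition dist_to (W : set V) (y : V) := inf [set N (y - w) | w in W].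

Lemma dist_to_sublinear (W : set V) :
  W 0 -> (forall v w, W v -> W w -> W (v + w)) ->
  (forall a v, W v -> W (a *: v)) ->
  sublinear (dist_to W) /\ forall y w, W w -> dist_to W y <= N (y - w).
Proof.
move=> W0 WD WZ.
have lb0 (y : V) : lbound [set N (y - w) | w in W] 0.
  by move=> _ [w _ <-]; exact: seminorm_ge0.
have dle (y w : V) : W w -> dist_to W y <= N (y - w).
  by move=> Ww; apply: ge_inf; [exists 0|exists w].
have ne (y : V) : [set N (y - w) | w in W] !=set0 by exists (N (y - 0)), 0.
split=> //; apply: sublinear_le => [|x y|a x a0].
- apply/eqP; rewrite eq_le lb_le_inf// andbT.
  by rewrite (le_trans (dle _ _ W0))// subr0 seminorm0.
- rewrite -lerBlDl; apply: lb_le_inf => // _ [w Ww <-].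
  rewrite lerBlDl -lerBlDr; apply: lb_le_inf => // _ [v Wv <-].
  rewrite lerBlDr; apply: le_trans (dle _ (v + w) _) _; first exact: WD.
  by rewrite opprD addrACA.
- rewrite -ler_pdivrMl//; apply: lb_le_inf => // _ [w Ww <-].
  rewrite ler_pdivrMl// -{2}(gtr0_norm a0) -NZ scalerBr.
  exact/dle/WZ.
Qed.

Lemma norming_functional x :
  exists u : {linear V -> R^o}, (forall y, u y <= N y) /\ u x = N x.
Proof. exact: hahn_banach seminorm_sublinear. Qed.

(** A functional dominated by the distance to [W] vanishes on [W], so [y] is at
  distance 0 from [W] as soon as it is killed by such functionals. *)
Lemma weakly_dense (W : set V) y :
  W 0 -> (forall v w, W v -> W w -> W (v + w)) ->
  (forall a v, W v -> W (a *: v)) ->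
  (forall u : {linear V -> R^o}, (forall z, u z <= N z) ->
    (forall w, W w -> u w = 0) -> u y = 0) ->
  forall e, 0 < e -> exists2 w, W w & N (y - w) < e.
Proof.
move=> W0 WD WZ Wy e e0.
have [dW dle] := dist_to_sublinear W0 WD WZ.
have [u [ud uy]] := hahn_banach y dW.
have dW0 w : W w -> u w <= 0.
  move=> Ww; rewrite (le_trans (ud w))// (le_trans (dle w w Ww))//.
  by rewrite subrr seminorm0.
have : dist_to W y < e.
  rewrite -uy (Wy u)// => [z|w Ww].
    by rewrite (le_trans (ud z))// (le_trans (dle z 0 W0))// subr0.
  apply/eqP; rewrite eq_le dW0//=.
  by have := dW0 _ (WZ (-1) _ Ww); rewrite linearZ/= scaleN1r oppr_le0.
by move=> /inf_lt[|_ [w Ww <-] ?]; [exists (N (y - 0)), 0|exists w].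
Qed.

Definition lincomb (v : nat -> V) (a : nat -> R) n := \sum_(i < n) a i *: v i.

Definition rat_lincomb (v : nat -> V) (q : seq rat) :=
  lincomb v (fun i => ratr q`_i) (size q).

(** The span of a sequence is separable, hence covered by countably many balls
  of any given radius. *)
Lemma rat_lincomb_dense v a n e : 0 < e ->
  exists q, N (lincomb v a n - rat_lincomb v q) < e.
Proof.
rewrite /rat_lincomb => e0.
suff: exists2 q, size q = n &
    N (lincomb v a n - lincomb v (fun i => ratr q`_i) (size q)) < e.
  by case=> q _ h; exists q.
elim: n e e0 => [|n IH] e e0.
  by exists [::] => //; rewrite /lincomb !big_ord0 subrr seminorm0.
have [|q sq hq] := IH (e / 2); first by rewrite divr_gt0.
(* The summand 1 keeps the denominator positive when [N (v n)] is 0. *)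
have d0 : 0 < e / 2 / (1 + N (v n)).
  by rewrite !divr_gt0// ltr_wpDr// seminorm_ge0.
have [r] := @rat_in_itvoo R (a n - e / 2 / (1 + N (v n))) (a n) ltac:(lra).
rewrite in_itv/= => /andP[r1 r2].
exists (rcons q r); first by rewrite size_rcons sq.
rewrite /lincomb size_rcons sq !big_ord_recr/= nth_rcons sq ltnn eqxx.
under [X in N (_ - (X + _))]eq_bigr => i _ do rewrite nth_rcons sq ltn_ord.
rewrite opprD addrACA (le_lt_trans (ND _ _))// -scalerBl NZ.
rewrite /lincomb sq in hq.
rewrite (splitr e) ltr_leD//.
rewrite ger0_norm; last lra.
apply: (@le_trans _ _ (e / 2 / (1 + N (v n)) * (1 + N (v n)))).
  by apply: ler_pM; have := seminorm_ge0 (v n); lra.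
by rewrite divfK// gt_eqF// ltr_wpDr// seminorm_ge0.
Qed.

(* [x S] plays the role of the sum of the subseries indexed by [S]. *)
Variable x : set nat -> V.
Hypothesis xD : forall A B, A `&` B = set0 -> x (A `|` B) = x A + x B.
(* Together with additivity this is weak continuity of [x] on the Cantor space
   of sets of naturals: for a given functional, sets that agree up to
   some [n] have close images. *)
Hypothesis weakly_null : forall u : {linear V -> R^o}, (forall y, u y <= N y) ->
  forall e, 0 < e -> exists n, forall S, S `<=` [set i | (n <= i)%N] ->
    `|u (x S)| <= e.

Lemma subsum_split n S : x S = x (S `&` [set i | (i < n)%N]) +
  x (S `&` [set i | (n <= i)%N]).
Proof.
rewrite -xD; last first.
  apply/seteqP; split=> i //= [[_ h1] [_ h2]].
  by have := leq_trans h1 h2; rewrite ltnn.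
congr x; apply/seteqP; split=> i /=; last by case=> -[].
by move=> Si; case: (ltnP i n) => h; [left|right].
Qed.

Lemma subsum0 : x set0 = 0.
Proof.
have := @xD set0 set0; rewrite setI0 setU0 => /(_ erefl)/eqP.
by rewrite addrC -subr_eq subrr => /eqP.
Qed.

Lemma subsum_initial n S : exists a,
  x (S `&` [set i | (i < n)%N]) = lincomb (fun i => x [set i]) a n.
Proof.
pose a i : R := (i \in S)%:R; exists a; rewrite /lincomb; elim: n => [|n IH].
  rewrite big_ord0 -subsum0; congr x.
  by apply/seteqP; split=> i //= [_]; rewrite ltn0.
rewrite (subsum_split n) big_ord_recr/= -IH; congr (x _ + _).
  apply/seteqP; split=> i /= [].
    by move=> [].
  by move=> Si in_; split=> //; split=> //; exact: leqW.
have [nS|nS] := boolP (n \in S); rewrite /a.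
  rewrite nS scale1r; congr x; apply/seteqP; split=> i /=.
    by move=> [[_ i1] i2]; apply/eqP; rewrite eqn_leq i2 -ltnS i1.
  by move=> ->; rewrite ltnSn leqnn; split=> //; split=> //; exact: set_mem.
rewrite (negbTE nS) scale0r -subsum0; congr x; apply/seteqP; split=> i //=.
move=> [[Si i1] i2]; move: nS.
have -> : n = i by apply/eqP; rewrite eqn_leq i2 -ltnS i1.
by rewrite (mem_set Si).
Qed.

(** The finite subsums lie in the span of the singletons, and every [x S] is a
  weak limit of finite subsums, hence a norm limit of elements of the span. *)
Lemma subsum_separable S e : 0 < e ->
  exists q, N (x S - rat_lincomb (fun i => x [set i]) q) < e.
Proof.
move=> e0; set v := fun i => x [set i].
pose W := [set w | exists a n, w = lincomb v a n].
have ext a n m : (n <= m)%N -> exists b, lincomb v a n = lincomb v b m.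
  move=> nm; exists (fun i => if (i < n)%N then a i else 0).
  rewrite /lincomb (big_ord_widen _ (fun i => a i *: v i) nm) big_mkcond/=.
  by apply: eq_bigr => i _; case: ifP => //; rewrite scale0r.
have [|||||w [a [n ->]] hw] := @weakly_dense W (x S) _ _ _ _ (e / 2).
- by exists (fun=> 0), 0%N; rewrite /lincomb big_ord0.
- move=> _ _ [a [n ->]] [b [m ->]].
  have [a' ->] := ext a n (maxn n m) (leq_maxl _ _).
  have [b' ->] := ext b m (maxn n m) (leq_maxr _ _).
  exists (fun i => a' i + b' i), (maxn n m).
  by rewrite /lincomb -big_split; apply: eq_bigr => i _; rewrite scalerDl.
- move=> c _ [a [n ->]]; exists (fun i => c * a i), n.
  by rewrite /lincomb scaler_sumr; apply: eq_bigr => i _; rewrite scalerA.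
- move=> u uN uW; apply/eqP; rewrite -normr_le0; apply/ler_addgt0Pr => d d0.
  have [n un] := weakly_null uN d0.
  rewrite add0r (subsum_split n) linearD/=.
  have [a ha] := subsum_initial n S.
  rewrite uW; last by exists a, n.
  by rewrite add0r; apply: un => i [].
- by rewrite divr_gt0.
have [|q hq] := @rat_lincomb_dense v a n (e / 2); first by rewrite divr_gt0.
exists q; rewrite -(subrKA (lincomb v a n)) (splitr e).
by rewrite (le_lt_trans (ND _ _))// ltrD.
Qed.

Definition agree n (S P : set nat) := forall i, (i < n)%N -> S i = P i.

(** One step of the category argument. The cylinder of the sets that agree with
  [P] up to [n] contains two sets whose images differ by some [x S] of norm
  more than [e], so one of the images is far from the given centre [c]. A
  norming functional witnesses this, and by weak continuity it still does on a
  smaller cylinder. *)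
Lemma escape_step e c n P : 0 < e ->
  (exists2 S, S `<=` [set i | (n <= i)%N] & e < N (x S)) ->
  exists m Q, [/\ (n <= m)%N, agree n Q P &
    forall S, agree m S Q -> e / 4 < N (x S - c)].
Proof.
move=> e0 [S0 S0n eS0].
pose P0 := P `&` [set i | (i < n)%N]; pose P1 := P0 `|` S0.
have P0S0 : P0 `&` S0 = set0.
  by apply/seteqP; split=> i //= [[_ /= +] /S0n/= h]; rewrite ltnNge h.
have [Q [QP hQ]] : exists Q, agree n Q P /\ e / 2 < N (x Q - c).
  have [h|h] := ltP (e / 2) (N (x P0 - c)).
    exists P0; split=> // i i_n; apply/propext; split=> [[]//|Pi].
    by split.
  exists P1; split.
    move=> i i_n; apply/propext; split=> [[[]//|/S0n/=]|Pi]; last by left.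
    by rewrite leqNgt i_n.
  have : N (x S0) <= N (x P1 - c) + N (x P0 - c).
    have -> : x S0 = (x P1 - c) - (x P0 - c).
      by rewrite /P1 xD// opprB addrA subrK addrAC subrr add0r.
    exact: seminormB.
  lra.
have [u [uN uQ]] := norming_functional (x Q - c).
have [|m um] := weakly_null uN (e := e / 8); first by rewrite divr_gt0.
exists (maxn n m), Q; split=> //; first exact: leq_maxl.
move=> S SQ; have := um (Q `&` [set i | (m <= i)%N]) ltac:(by move=> i []).
have := um (S `&` [set i | (m <= i)%N]) ltac:(by move=> i []).
have eSQ : S `&` [set i | (i < m)%N] = Q `&` [set i | (i < m)%N].
  apply/seteqP; split=> i /= [Si im]; split=> //; move: Si;
    by rewrite SQ// leq_max im orbT.
move: uQ (uN (x S - c)).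
rewrite !linearB/= (subsum_split m S) (subsum_split m Q) !linearD/= eSQ.
rewrite !ler_norml -!(subsum_split m) => uQ h /andP[h1 h2] /andP[h3 h4].
by move: hQ; rewrite -uQ; lra.
Qed.

(** If the conclusion fails for [e], [escape_step] yields nested cylinders whose
  images avoid balls of radius [e / 4] centred at all the points of a countable
  dense set; the image of a common point of the cylinders avoids them all,
  against separability. *)
Theorem orlicz_pettis e : 0 < e -> exists n, forall S,
  S `<=` [set i | (n <= i)%N] -> N (x S) <= e.
Proof.
move=> e0; apply: contrapT => /forallNP noN.
have bad n : exists2 S, S `<=` [set i | (n <= i)%N] & e < N (x S).
  have /existsNP[S /not_implyP[Sn /negP]] := noN n.
  by rewrite -ltNge => h; exists S.
pose c j := rat_lincomb (fun i => x [set i]) (odflt [::] (unpickle j)).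
pose step j (s : nat * set nat) (t : nat * set nat) :=
  [/\ (s.1 <= t.1)%N, agree s.1 t.2 s.2 &
    forall S, agree t.1 S t.2 -> e / 4 < N (x S - c j)].
have /choice[f hf] : forall js : nat * (nat * set nat), exists t,
    step js.1 js.2 t.
  move=> [j [n P]]; have [m [Q hQ]] := escape_step (c j) P e0 (bad n).
  by exists (m, Q).
pose st := fix st j := if j is j'.+1 then f (j', st j') else (0%N, set0).
have stS j : step j (st j) (st j.+1) by exact: (hf (j, st j)).
have mono i j : (i <= j)%N ->
    ((st i).1 <= (st j).1)%N /\ agree (st i).1 (st j).2 (st i).2.
  elim: j => [|j IH]; first by rewrite leqn0 => /eqP ->.
  rewrite leq_eqVlt => /orP[/eqP -> //|/IH[h1 h2]].
  have [h3 h4 _] := stS j; split; first exact: leq_trans h1 h3.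
  by move=> k kn; rewrite h4 ?h2// (leq_trans kn h1).
pose S := [set i | exists2 j, (i < (st j).1)%N & (st j).2 i].
have SQ j : agree (st j).1 S (st j).2.
  move=> i ij; apply/propext; split=> [[k ik Qi]|Qi]; last by exists j.
  have [jk|kj] := leqP j k.
    by have [_ <-] := mono _ _ jk.
  by have [_ ->] := mono _ _ (ltnW kj).
have [|q hq] := subsum_separable S (e := e / 4); first by rewrite divr_gt0.
have [_ _ /(_ S (SQ _))] := stS (pickle q).
by rewrite /c pickleK/= => /(lt_trans hq); rewrite ltxx.
Qed.

End OrliczPettis.

(** * Real and complex scalars *)

Section Scalars.
Context (R : realType) (k : RorC).
Local Notation K := (scalar_field R k).

Definition scalar_emb : R -> K :=
  match k with
  | RealScalars => fun a => a
  | ComplexScalars => fun a => (a%:C)%C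
  end.

Lemma scalar_embD a b : scalar_emb (a + b) = scalar_emb a + scalar_emb b.
Proof. by rewrite /scalar_emb; case: k => //=; rewrite rmorphD. Qed.

Lemma scalar_embM a b : scalar_emb (a * b) = scalar_emb a * scalar_emb b.
Proof. by rewrite /scalar_emb; case: k => //=; rewrite rmorphM. Qed.

Lemma scalar_emb1 : scalar_emb 1 = 1.
Proof. by rewrite /scalar_emb; case: k => //=; rewrite rmorph1. Qed.

Lemma scalar_emb0 : scalar_emb 0 = 0.
Proof. by rewrite /scalar_emb; case: k => //=; rewrite rmorph0. Qed.

Lemma le_scalar_emb a b : (scalar_emb a <= scalar_emb b) = (a <= b).
Proof. by rewrite /scalar_emb; case: k => //=; rewrite lecR. Qed.

Lemma lt_scalar_emb a b : (scalar_emb a < scalar_emb b) = (a < b).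
Proof. by rewrite /scalar_emb; case: k => //=; rewrite ltcR. Qed.

Lemma norm_scalar_emb a : `|scalar_emb a| = scalar_emb `|a|.
Proof.
rewrite /scalar_emb; case: k => //=; rewrite normc_def/= expr0n addr0.
by rewrite sqrtr_sqr.
Qed.

Lemma ge0_scalar_reK (z : K) : 0 <= z -> scalar_emb (scalar_re z) = z.
Proof.
rewrite /scalar_emb /scalar_re; move: z; case: k => //= -[a b].
by rewrite lecE/= => /andP[/eqP -> _].
Qed.

Lemma scalar_reD (y z : K) : scalar_re (y + z) = scalar_re y + scalar_re z.
Proof. by rewrite /scalar_re; move: y z; case: k => //= -[a b] [c e]. Qed.

Lemma scalar_reN (z : K) : scalar_re (- z) = - scalar_re z.
Proof. by rewrite /scalar_re; move: z; case: k => //= -[a b]. Qed.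

Lemma scalar_reB (y z : K) : scalar_re (y - z) = scalar_re y - scalar_re z.
Proof. by rewrite scalar_reD scalar_reN. Qed.

Lemma scalar_imD (y z : K) : scalar_im (y + z) = scalar_im y + scalar_im z.
Proof.
rewrite /scalar_im; move: y z; case: k => [y z|[a b] [c e]]//=.
by rewrite addr0.
Qed.

Lemma scalar_re_emb_mul a (z : K) :
  scalar_re (scalar_emb a * z) = a * scalar_re z.
Proof.
rewrite /scalar_re /scalar_emb; move: z; case: k => //= -[b c]/=.
by rewrite mul0r subr0.
Qed.

Lemma norm_scalar_re (z : K) : `|scalar_re z| <= scalar_re `|z|.
Proof.
rewrite -le_scalar_emb ge0_scalar_reK//.
rewrite /scalar_re /scalar_emb; move: z; case: k => //= z.
exact: normc_ge_Re.
Qed.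

Lemma norm_scalar_im (z : K) : `|scalar_im z| <= scalar_re `|z|.
Proof.
rewrite /scalar_re /scalar_im; move: z; case: k => [z|[a b]]/=.
  by rewrite normr0.
by rewrite -sqrtr_sqr ler_wsqrtr// lerDr sqr_ge0.
Qed.

(** Restriction of scalars to the reals; an alias, because it changes the
  module structure of [X]. *)
Definition realified (X : lmodType K) : Type := X.

HB.instance Definition _ (X : lmodType K) := GRing.Zmodule.on (realified X).

Section Realified.
Variable X : lmodType K.

Definition real_scale (a : R) (x : realified X) : realified X :=
  scalar_emb a *: (x : X).

Fact real_scaleA a b (x : realified X) :
  real_scale a (real_scale b x) = real_scale (a * b) x.
Proof. by rewrite /real_scale scalerA scalar_embM. Qed.

Fact real_scale1 : left_id 1 real_scale.
Proof. by move=> x; rewrite /real_scale scalar_emb1 scale1r. Qed.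

Fact real_scaleDr : right_distributive real_scale +%R.
Proof. by move=> a x y; rewrite /real_scale scalerDr. Qed.

Fact real_scaleDl (x : realified X) : {morph real_scale^~ x : a b / a + b}.
Proof. by move=> a b; rewrite /real_scale scalar_embD scalerDl. Qed.

HB.instance Definition _ := GRing.Zmodule_isLmodule.Build R (realified X)
  real_scaleA real_scale1 real_scaleDr real_scaleDl.
End Realified.

End Scalars.
Arguments scalar_emb {R k}.

Section RealNorm.
Context (R : realType) (k : RorC).
Local Notation K := (scalar_field R k).

(** The norm of [X] takes its values in the scalar field; the estimates are made
  in [R]. *)
Definition real_norm (X : normedModType K) (x : X) : R := scalar_re `|x|.

Context (X : normedModType K).

Lemma real_normE (x : X) : scalar_emb (real_norm x) = `|x|.
Proof. exact: ge0_scalar_reK. Qed.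

Lemma real_normD (x y : X) : real_norm (x + y) <= real_norm x + real_norm y.
Proof. by rewrite -(@le_scalar_emb _ k) scalar_embD !real_normE ler_normD. Qed.

Lemma real_normZ a (x : X) : real_norm (scalar_emb a *: x) = `|a| * real_norm x.
Proof. by rewrite /real_norm normrZ norm_scalar_emb scalar_re_emb_mul. Qed.

Lemma real_norm0_eq0 (x : X) : real_norm x = 0 -> x = 0.
Proof.
by move=> h; apply/eqP; rewrite -normr_eq0 -real_normE h scalar_emb0.
Qed.

Lemma le_real_norm (x : X) e : (real_norm x <= e) = (`|x| <= scalar_emb e).
Proof. by rewrite -real_normE le_scalar_emb. Qed.

End RealNorm.

Section RealNormTopology.
Context (R : realType) (k : RorC).
Local Notation K := (scalar_field R k).
Context (X : normedModType K).

Lemma cvg_real_norm (u : nat -> X) (l : X) :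
  (forall e, 0 < e -> exists n, forall m, (n <= m)%N ->
    real_norm (l - u m) <= e) <->
  u n @[n --> \oo] --> l.
Proof.
split=> [h|].
  apply/cvgrPdist_le => e e0; have : 0 < scalar_re e.
    by rewrite -(@lt_scalar_emb _ k) ge0_scalar_reK ?ltW// scalar_emb0.
  move=> /h[n hn]; exists n => // m /= nm.
  by have := hn m nm; rewrite le_real_norm ge0_scalar_reK// ltW.
move=> /cvgrPdist_le h e e0; have : 0 < (scalar_emb e : K).
  by rewrite -(@scalar_emb0 R k) lt_scalar_emb.
move=> /h[n _ hn]; exists n => m nm.
by rewrite le_real_norm; exact: hn.
Qed.

Lemma continuous_linear_bound (x' : {linear X -> K^o}) : continuous x' ->
  exists2 C, 0 < C & forall y, real_norm (x' y : K^o) <= C * real_norm y.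
Proof.
move=> /linear_bounded_continuous /linear_boundedP h.
have [c [c0 hc]] := pinfty_ex_gt0 h.
exists (scalar_re c).
  by rewrite -(@lt_scalar_emb _ k) ge0_scalar_reK ?ltW// scalar_emb0.
move=> y; have := hc y.
rewrite -(@le_scalar_emb _ k) scalar_embM !real_normE.
by rewrite (ge0_scalar_reK (ltW c0)).
Qed.

Lemma bound_linear_continuous (x' : {linear X -> K^o}) C :
  (forall y, real_norm (x' y : K^o) <= C * real_norm y) -> continuous x'.
Proof.
move=> h; apply/linear_bounded_continuous/linear_boundedP.
near=> c => y; have := h y.
rewrite -(@le_scalar_emb _ k) scalar_embM !real_normE => /le_trans; apply.
rewrite ler_wpM2r//; near: c; apply: nbhs_pinfty_ge.
have [C0|C0] := leP 0 C.
  by rewrite ger0_real// -(@scalar_emb0 R k) le_scalar_emb.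
by rewrite ler0_real// -(@scalar_emb0 R k) le_scalar_emb ltW.
Unshelve. all: by end_near. Qed.

End RealNormTopology.

(** A bounded real functional [u] is the real part of a bounded scalar one: over
  the complex numbers, of [u y - 'i u ('i y)]. *)
Lemma complexify (R : realType) (k : RorC)
    (X : normedModType (scalar_field R k))
    (u : {linear realified X -> R^o}) : (forall y, u y <= @real_norm R k X y) ->
  exists x' : {linear X -> (scalar_field R k)^o},
    continuous x' /\ forall y, scalar_re (x' y) = u y.
Proof.

case: k X u => [X u hu|X u hu].
  pose f : X -> R^o := u.
  have fl : linear f by move=> a x y; rewrite /f -linearP.
  pose F : {linear X -> R^o} :=
    HB.pack f (GRing.isLinear.Build R X R^o *:%R f fl).
  exists F; split=> //; apply: (@bound_linear_continuous _ RealScalars X F 1).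
  move=> y; rewrite mul1r /real_norm/= ler_norml hu andbT.
  have := hu (- y); rewrite linearN /real_norm/= normrN; lra.
pose nX (y : X) := @real_norm R ComplexScalars X y.
pose f (y : X) : R[i] := (u y +i* (- u ('i%C *: y)))%C.
have uD (x y : X) : u (x + y) = u x + u y by exact: (linearD u).
have uZ (a : R) (x : X) : u ((a%:C)%C *: x) = a * u x.
  by rewrite -[LHS]/(u (a *: (x : realified X))) linearZ.
have uN (x : X) : u (- x) = - u x by exact: (linearN u).
have fl : linear (f : X -> (R[i])^o).
  move=> [a b] x y; rewrite /f.
  have e (v : X) :
      (a +i* b)%C *: v = (a%:C)%C *: v + (b%:C)%C *: ('i%C *: v).
    rewrite scalerA -scalerDl; congr (_ *: _).
    by apply/eqP; rewrite eq_complex/=; apply/andP; split; apply/eqP; ring.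
  have ii (v : X) : 'i%C *: ('i%C *: v) = - v.
    by rewrite scalerA -expr2 sqr_i scaleN1r.
  rewrite scalerDr [X in u (X + _)]e !uD !uZ.
  have -> : 'i%C *: ((a +i* b)%C *: x) = (a +i* b)%C *: ('i%C *: x).
    by rewrite !scalerA mulrC.
  rewrite e !uD !uZ ii uN.
  by apply/eqP; rewrite eq_complex/=; apply/andP; split; apply/eqP; ring.
pose F : {linear X -> (R[i])^o} :=
  HB.pack (f : X -> (R[i])^o)
    (GRing.isLinear.Build R[i] X (R[i])^o *:%R f fl).
have ub (y : X) : `|u y| <= nX y.
  rewrite ler_norml hu andbT; have := hu (- y); rewrite uN.
  by rewrite [leRHS](_ : _ = nX y) /nX /real_norm ?normrN//; lra.
exists F; split=> //; apply: (@bound_linear_continuous _ ComplexScalars X F 2).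
move=> y.
have iy : nX ('i%C *: y) = nX y.
  rewrite /nX /real_norm normrZ normc_def/=.
  by rewrite expr0n add0r expr1n sqrtr1 mul1r.
have := ub y; have := ub ('i%C *: y); rewrite iy => h1 h2.
have n0 : 0 <= nX y by exact: le_trans (ub y).
apply: (@le_trans _ _ (Num.sqrt ((2 * nX y) ^+ 2))).
  apply: ler_wsqrtr; rewrite sqrrN exprMn.
  have := lerXn2r 2 (normr_ge0 _) n0 h1.
  have := lerXn2r 2 (normr_ge0 _) n0 h2.
  rewrite !real_normK ?num_real//; have := sqr_ge0 (nX y).
  lra.
by rewrite sqrtr_sqr ger0_norm// mulr_ge0.
Qed.

Lemma cauchy_real_norm (R : realType) (k : RorC)
    (X : completeNormedModType (scalar_field R k)) (u : nat -> X) :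
  (forall e, 0 < e -> exists n, forall m, (n <= m)%N ->
    real_norm (u n - u m) <= e) ->
  exists l : X, u n @[n --> \oo] --> l.
Proof.
move=> h.
suff : cvgn u by move=> c; exists (limn u).
apply: cauchy_cvg; apply/cauchy_exP => e e0.
have : 0 < scalar_re e / 2.
  by rewrite divr_gt0// -(@lt_scalar_emb _ k) ge0_scalar_reK ?ltW// scalar_emb0.
move=> e2; have [n hn] := h _ e2.
exists (u n); exists n => // m nm; rewrite -ball_normE/=.
rewrite -real_normE -[ltRHS]ge0_scalar_reK ?ltW// lt_scalar_emb.
by rewrite (le_lt_trans (hn m nm))//; lra.
Qed.

Lemma dual_separates (R : realType) (k : RorC)
    (X : normedModType (scalar_field R k)) (x y : X) :
  (forall x' : {linear X -> (scalar_field R k)^o}, continuous x' ->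
    scalar_re (x' x) = scalar_re (x' y)) -> x = y.
Proof.
move=> h; apply/eqP; rewrite -subr_eq0; apply/eqP/real_norm0_eq0.
have [u [un <-]] := @norming_functional _ (realified X) (@real_norm R k X)
  (@real_normD _ _ _) (@real_normZ _ _ _) (x - y).
have [x' [cx' <-]] := complexify un.
by rewrite linearB scalar_reB h// subrr.
Qed.

Section ScalarPart.
Context (R : realType) (k : RorC).
Local Notation K := (scalar_field R k).

(** Indexing by a boolean lets one argument cover the real and the imaginary
  part. *)
Definition scalar_part (b : bool) : K -> R :=
  if b then @scalar_re R k else @scalar_im R k.

Lemma scalar_partD b (y z : K) :
  scalar_part b (y + z) = scalar_part b y + scalar_part b z.
Proof. by case: b; [exact: scalar_reD|exact: scalar_imD]. Qed.

Lemma scalar_part0 b : scalar_part b 0 = 0.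
Proof.
by apply: (addrI (scalar_part b 0)); rewrite -scalar_partD !addr0.
Qed.

Lemma scalar_partB b (y z : K) :
  scalar_part b (y - z) = scalar_part b y - scalar_part b z.
Proof.
by rewrite -[LHS](addrK (scalar_part b z)) -scalar_partD subrK.
Qed.

Lemma norm_scalar_part b (z : K) : `|scalar_part b z| <= scalar_re `|z|.
Proof. by case: b; [exact: norm_scalar_re|exact: norm_scalar_im]. Qed.

Lemma cvg_scalar_part b (u : nat -> K^o) (l : K^o) :
  u n @[n --> \oo] --> l ->
  scalar_part b (u n) @[n --> \oo] --> scalar_part b l.
Proof.
move=> /cvg_real_norm h; apply/cvgrPdist_le => e /h[n hn].
exists n => // m /= nm; rewrite -scalar_partB.
exact: le_trans (norm_scalar_part _ _) (hn _ nm).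
Qed.

End ScalarPart.

(** * Sets of finite measure *)

Section FiniteMeasureSets.
Context (R : realType) (d : measure_display) (T : measurableType d).
Variable mu : {measure set T -> \bar R}.

Lemma finite_measS C D : finite_meas mu C -> measurable D -> D `<=` C ->
  finite_meas mu D.
Proof.
move=> [mC fC] mD DC; split=> //.
by apply: le_lt_trans fC; rewrite le_measure// inE.
Qed.

Lemma finite_measU C D : finite_meas mu C -> finite_meas mu D ->
  finite_meas mu (C `|` D).
Proof.
move=> [mC fC] [mD fD]; split; first exact: measurableU.
by rewrite (le_lt_trans (measureU2 _ mC mD))// lte_add_pinfty.
Qed.

Lemma finite_meas0 : finite_meas mu set0.
Proof. by split=> //; rewrite measure0. Qed.

Fixpoint unions_upto (B : nat -> set T) n :=
  if n is m.+1 then unions_upto B m `|` B n else B 0%N.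

Lemma unions_upto_homo B :
  {homo unions_upto B : n m / (n <= m)%N >-> n `<=` m}.
Proof.
move=> n m; elim: m => [|m IH]; first by rewrite leqn0 => /eqP ->.
by rewrite leq_eqVlt => /orP[/eqP -> //|/IH h] t /h; left.
Qed.

Lemma sub_unions_upto B n : B n `<=` unions_upto B n.
Proof. by case: n => [|n] t // Bt; right. Qed.

Lemma finite_meas_unions_upto B n : (forall n, finite_meas mu (B n)) ->
  finite_meas mu (unions_upto B n).
Proof. by move=> fB; elim: n => [|n IH] //=; exact: finite_measU. Qed.

End FiniteMeasureSets.

(** * Integrals of real functions *)

Section RealIntegrals.
Context (R : realType) (d : measure_display) (T : measurableType d).
Variable mu : {measure set T -> \bar R}.
Implicit Types (A B C : set T) (r s : T -> R).

Lemma Rintegral_setD A B r : measurable A -> measurable B -> B `<=` A ->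
  mu.-integrable A (EFin \o r) ->
  \int[mu]_(t in A `\` B) r t = \int[mu]_(t in A) r t - \int[mu]_(t in B) r t.
Proof.
move=> mA mB BA iA.
have BU : B `|` (A `\` B) = A by exact: setDUK.
rewrite -[in X in _ = X - _]BU Rintegral_setU ?BU//; last first.
- by apply/disj_setPS => t [Bt []].
- exact: measurableD.
by rewrite addrAC subrr add0r.
Qed.

Lemma ae_eq_integrable A r s : measurable A -> measurable_fun A s ->
  mu.-integrable A (EFin \o r) -> {ae mu, forall t, A t -> r t = s t} ->
  mu.-integrable A (EFin \o s) /\
  \int[mu]_(t in A) r t = \int[mu]_(t in A) s t.
Proof.
move=> mA ms ir rs.
have mr := measurable_int mu ir.
have mes : measurable_fun A (EFin \o s) by exact/measurable_EFinP.
split; last first.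
  congr fine; apply: ae_eq_integral => //.
  by apply: filterS rs => t /= h At; rewrite h.
apply/integrableP; split=> //.
move/integrableP : ir => [_]; congr (_ < _)%E.
apply: ae_eq_integral => //; do ?exact: measurableT_comp.
by apply: filterS rs => t /= h At; rewrite h.
Qed.

(** Uniform smallness of the tails of an integral, from which both weak
  continuity in the Orlicz-Pettis theorem and convergence along an exhaustion
  of [A] are read off. *)
Lemma integral_tail A r (H : nat -> set T) : measurable A ->
  mu.-integrable A (EFin \o r) -> (forall n, measurable (H n)) ->
  {homo H : n m / (n <= m)%N >-> n `<=` m} ->
  (forall t, A t -> ~ (\bigcup_n H n) t -> r t = 0) ->
  forall e, 0 < e -> exists n, forall C, measurable C -> C `<=` A `\` H n ->
    `|\int[mu]_(t in C) r t| <= e.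
Proof.
move=> mA ir mH Hmono r0 e e0.
pose a t := `|r t|.
have ia : mu.-integrable A (EFin \o a) by exact: integrable_norm.
have mr : measurable_fun A r by apply/measurable_EFinP/(measurable_int mu ir).
have mea : measurable_fun A (EFin \o a) by exact: measurable_int ia.
have mAH n : measurable (A `&` H n) by exact: measurableI.
pose U := \bigcup_n (A `&` H n).
have mU : measurable U by exact: bigcup_measurable.
have UA : U `<=` A by move=> t [n _ []].
have AHA n : A `&` H n `<=` A by move=> t [].
have AU : \int[mu]_(t in U) a t = \int[mu]_(t in A) a t.
  apply/eqP; rewrite eq_sym -subr_eq0 -Rintegral_setD//.
  rewrite (@eq_Rintegral _ _ _ _ _ (cst 0)) ?Rintegral_cst ?mul0r//.
    exact: measurableD.
  move=> t /set_mem[At Ut]; rewrite /a r0 ?normr0// => -[n _ Ht].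
  by apply: Ut; exists n.
have iU : mu.-integrable U (EFin \o a) by exact: integrableS ia.
have : (\int[mu]_(t in A `&` H n) (EFin \o a) t)%E @[n --> \oo] -->
    (\int[mu]_(t in U) (EFin \o a) t)%E.
  apply: ge0_nondecreasing_set_cvg_integral => //.
  - by move=> n m nm; apply/subsetPset; apply: setIS; exact: Hmono.
  - by move=> n; exact: measurable_funS mea.
  - by move=> n t _; rewrite /= lee_fin /a normr_ge0.
rewrite -[X in _ --> X -> _]fineK; last exact: integrable_fin_num.
move=> /fine_cvgP[_] /cvgrPdist_le /(_ e e0)[n _ /(_ n (leqnn n))] /= hn.
exists n => C mC CA.
have iC : mu.-integrable C (EFin \o r).
  by apply: integrableS ir => // t /CA[].
rewrite (le_trans (le_normr_Rintegral mC iC))//.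
have iAH : mu.-integrable (A `\` (A `&` H n)) (EFin \o a).
  by apply: integrableS ia => //; exact: measurableD.
apply: (@le_trans _ _ (\int[mu]_(t in A `\` (A `&` H n)) a t)); last first.
  rewrite Rintegral_setD// -AU; apply: le_trans hn.
  by rewrite /Rintegral ler_norm.
rewrite fine_le//.
- by apply: integrable_fin_num => //; apply: integrableS ia => // t /CA[].
- by apply: integrable_fin_num => //; exact: measurableD.
- apply: ge0_subset_integral => //; first exact: measurableD.
  + by apply: measurable_funS mea => //; exact: measurableD.
  + by move=> t /CA[At Ht]; split=> // -[].
Qed.

(** Over a set of finite measure, the integral of the modulus of [r] is the
  difference of two integrals of [r], on the sets where [r] has constant sign.
  Outside [B] these are bounded by [M], so the modulus has integral at most
  [2 * M] there. *)
Lemma integrable_of_tail r (E : nat -> set T) : measurable_fun setT r ->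
  (forall n, finite_meas mu (E n)) ->
  {homo E : n m / (n <= m)%N >-> n `<=` m} ->
  (forall t, ~ (\bigcup_n E n) t -> r t = 0) ->
  (forall B, finite_meas mu B -> mu.-integrable B (EFin \o r)) ->
  (exists B M, finite_meas mu B /\ forall C, finite_meas mu C ->
    C `&` B = set0 -> `|\int[mu]_(t in C) r t| <= M) ->
  mu.-integrable setT (EFin \o r).
Proof.
move=> mr fE Emono r0 locr [B [M [fB hM]]].
have mer : measurable_fun setT (EFin \o r) by exact/measurable_EFinP.
pose a t := `|r t|.
have mea : measurable_fun setT (EFin \o a).
  by apply/measurable_EFinP; exact: measurableT_comp.
have loca C : finite_meas mu C -> mu.-integrable C (EFin \o a).
  by move=> fC; apply: integrable_norm; exact: locr.
have fS := @finite_measS R d T mu.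
pose P := [set t | 0 <= r t].
have mP : measurable P.
  rewrite -[P]setTI.
  exact: (measurable_fun_le measurableT (measurable_cst _) mr).
have tail C : finite_meas mu C -> C `&` B = set0 ->
    \int[mu]_(t in C) a t <= 2 * M.
  move=> fC CB; have mC := fC.1.
  have f1 : finite_meas mu (C `&` P).
    by apply: (fS C) => //; exact: measurableI.
  have f2 : finite_meas mu (C `\` P).
    by apply: (fS C) => //; exact: measurableD.
  have -> : \int[mu]_(t in C) a t =
      \int[mu]_(t in C `&` P) r t - \int[mu]_(t in C `\` P) r t.
    rewrite -[in LHS](setUIDK C P) Rintegral_setU ?setUIDK//; first last.
    + by apply/disj_setPS => t [[_ ?] [_]].
    + exact: loca.
    + exact: f2.1.
    + exact: f1.1.
    congr (_ + _).
      by apply: eq_Rintegral => t /set_mem[_ ?]; rewrite /a ger0_norm.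
    rewrite -mulN1r -RintegralZl//; [|exact: f2.1|exact: locr].
    apply: eq_Rintegral => t /set_mem[_ /negP]; rewrite -ltNge mulN1r => rt.
    by rewrite /a ltr0_norm.
  have h1 := hM _ f1; have h2 := hM _ f2.
  have {}h1 : `|\int[mu]_(t in C `&` P) r t| <= M.
    by apply: h1; rewrite setIAC CB set0I.
  have {}h2 : `|\int[mu]_(t in C `\` P) r t| <= M.
    by apply: h2; rewrite setDE setIAC CB set0I.
  by move: h1 h2; rewrite !ler_norml => /andP[? ?] /andP[? ?]; lra.
have bound n : (\int[mu]_(t in E n) (EFin \o a) t <=
    (\int[mu]_(t in B) a t + 2 * M)%:E)%E.
  have mE := (fE n).1.
  have mB := fB.1.
  have f1 : finite_meas mu (E n `&` B).
    by apply: (fS (E n)) => //; exact: measurableI.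
  have f2 : finite_meas mu (E n `\` B).
    by apply: (fS (E n)) => //; exact: measurableD.
  rewrite -[leLHS]fineK; last by apply: integrable_fin_num => //; exact: loca.
  rewrite lee_fin -[X in X <= _]/(\int[mu]_(t in E n) a t).
  rewrite -[in leLHS](setUIDK (E n) B) Rintegral_setU ?setUIDK//; first last.
  + by apply/disj_setPS => t [[_ ?] [_]].
  + exact: loca.
  + exact: f2.1.
  + exact: f1.1.
  rewrite lerD//; last first.
    by apply: tail => //; apply/seteqP; split=> t //= [[_ ?] ?].
  rewrite fine_le//.
  + by apply: integrable_fin_num; [exact: f1.1|exact: loca].
  + by apply: integrable_fin_num => //; exact: loca.
  + apply: ge0_subset_integral => //; [exact: f1.1| |].
      exact: measurable_funS mea.
    by move=> t _; rewrite /= lee_fin /a normr_ge0.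
apply/integrableP; split=> //.
have mU : measurable (\bigcup_n E n).
  by apply: bigcup_measurable => n _; exact: (fE n).1.
have -> : (\int[mu]_t `|(EFin \o r) t|)%E =
    (\int[mu]_(t in \bigcup_n E n) (EFin \o a) t)%E.
  rewrite [RHS]integral_mkcond; apply: eq_integral => t _ /=.
  rewrite patchE; case: ifPn => // /negP Ut.
  by rewrite r0 ?normr0// => /mem_set.
apply: (@le_lt_trans _ _ (\int[mu]_(t in B) a t + 2 * M)%:E); last exact: ltry.
apply: (cvge_le _ (@ge0_nondecreasing_set_cvg_integral
  _ _ _ E (EFin \o a) mu _ _ _ _)).
- by near=> n; exact: bound.
- by move=> n m nm; apply/subsetPset; exact: Emono.
- by move=> n; exact: (fE n).1.
- by move=> n; exact: measurable_funS mea.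
- by move=> n t _; rewrite /= lee_fin /a normr_ge0.
Unshelve. all: by end_near. Qed.

End RealIntegrals.

(** * Measurable versions of scalar functions *)

Section Versions.
Context (R : realType) (k : RorC) (d : measure_display) (T : measurableType d).
Variable mu : {measure set T -> \bar R}.
Local Notation K := (scalar_field R k).

Lemma simple_comp_measurable (s : T -> K^o) (phi : K -> R) :
  simple_finite_support mu s -> measurable_fun setT (phi \o s).
Proof.
move=> [fs ms _] _ Y mY; rewrite setTI.
have -> : (phi \o s) @^-1` Y =
    \bigcup_(y in range s `&` phi @^-1` Y) s @^-1` [set y].
  apply/seteqP; split=> t /=; last by case=> y [_ /= ?] /= ->.
  by move=> Yt; exists (s t) => //; split=> //; exists t.
apply: fin_bigcup_measurable => //.
exact: sub_finite_set fs.
Qed.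

(** The form in which strong measurability of a scalar function is used. The
  sets [E n] are the reason why [x' \o F] is determined by its behaviour on sets
  of finite measure. *)
Record sigma_finite_version (f h : T -> K) (E : nat -> set T) : Prop := {
  version_ae : {ae mu, forall t, f t = h t};
  version_meas : forall b, measurable_fun setT (scalar_part b \o h);
  version_fin : forall n, finite_meas mu (E n);
  version_homo : {homo E : n m / (n <= m)%N >-> n `<=` m};
  version_supp : forall t, ~ (\bigcup_n E n) t -> h t = 0 }.

Lemma strongly_measurable_version (f : T -> K^o) : strongly_measurable mu f ->
  exists h E, sigma_finite_version f h E.
Proof.
move=> [s ss [N [mN N0 sN]]].
pose h t : K := if t \in N then 0 else f t.
pose S n := [set t | s n t != 0].
have fS n : finite_meas mu (S n).
  have [_ ms fs] := ss n; split=> //.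
  have -> : S n = ~` (s n @^-1` [set 0]).
    by apply/seteqP; split=> t /= /eqP.
  exact: measurableC.
have cN t : t \notin N -> s n t @[n --> \oo] --> f t.
  by move=> /negP tN; apply: contrapT => /sN /mem_set.
exists h, (unions_upto S); split.
- exists N; split=> // t /= ft; apply: contrapT => tN; apply: ft.
  by rewrite /h ifN//; apply/negP => /set_mem.
- move=> b; pose g n t := if t \in N then 0 else scalar_part b (s n t).
  apply: (@measurable_fun_cvg _ _ _ _ g) => [n|t _].
    apply: measurable_fun_ifT => //.
      apply: (measurable_fun_bool true); rewrite setTI.
      rewrite (_ : _ @^-1` _ = N)//.
      by apply/seteqP; split=> t' /= => [/set_mem|/mem_set].
    exact: simple_comp_measurable (ss n).
  rewrite /g /h /=; have [tN|tN] := boolP (t \in N).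
    by rewrite scalar_part0; exact: cvg_cst.
  exact/cvg_scalar_part/cN.
- by move=> n; exact: finite_meas_unions_upto.
- exact: unions_upto_homo.
- move=> t tS; rewrite /h; case: ifPn => // /cN /cvg_real_norm c.
  have s0 n : s n t = 0.
    apply: contrapT => /eqP st; apply: tS; exists n => //.
    exact: sub_unions_upto.
  apply: (@real_norm0_eq0 R k K^o); apply/eqP; rewrite eq_le; apply/andP; split.
    apply/ler_addgt0Pr => e /c[n /(_ n (leqnn n))].
    by rewrite s0 subr0 add0r.
  exact: (@le_trans _ _ _ _ _ (normr_ge0 _) (norm_scalar_re _)).
Qed.

End Versions.

(** * Restriction of Pettis integrable functions *)

Section Restriction.
Context (R : realType) (k : RorC) (d : measure_display) (T : measurableType d).
Variable mu : {measure set T -> \bar R}.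
Local Notation K := (scalar_field R k).
Context (X : completeNormedModType K).

Lemma chi_mulE B (F : T -> X) t : chi_mul B F t = if t \in B then F t else 0.
Proof.
by rewrite /chi_mul indicE; case: (t \in B); rewrite ?scale1r ?scale0r.
Qed.

Lemma weakly_measurable_chi_mul B (F : T -> X) : measurable B ->
  weakly_measurable mu F -> weakly_measurable mu (chi_mul B F).
Proof.
move=> mB wF x' cx'; have [s ss sF] := wF x' cx'.
exists (fun n t => if t \in B then s n t else 0) => [n|]; last first.
  apply: filterS sF => t st; rewrite chi_mulE; case: ifPn => // _.
  by rewrite linear0; exact: cvg_cst.
have [fs ms [fin]] := ss n; split.
- apply: (@sub_finite_set _ _ (range (s n) `|` [set 0])).
    by move=> _ [t _ <-]; case: ifP => _; [left; exists t|right].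
  by rewrite finite_setU.
- move=> y.
  have -> : (fun t => if t \in B then s n t else 0) @^-1` [set y] =
      (B `&` s n @^-1` [set y]) `|` (~` B `&` [set t | 0 = y]).
    apply/seteqP; split=> t /=.
      case: ifPn => [/set_mem|/negP] Bt ty; first by left.
      by right; split=> // /mem_set.
    case=> [[Bt st]|[Bt y0]]; first by rewrite mem_set.
    by rewrite ifN//; apply/negP => /set_mem.
  apply: measurableU; apply: measurableI => //; first exact: measurableC.
  have [->|y0] := eqVneq y 0.
    by rewrite (_ : [set _ | _] = setT)//; apply/seteqP; split.
  rewrite (_ : [set _ | _] = set0)//; apply/seteqP; split=> t //= y0'.
  by rewrite -y0' eqxx in y0.
- apply: le_lt_trans (_ : (mu [set t | s n t != 0%R] < +oo)%E) => //.
  have mS : measurable [set t | s n t != 0].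
    rewrite (_ : [set _ | _] = ~` (s n @^-1` [set 0])).
      exact: measurableC.
    by apply/seteqP; split=> t /= /eqP.
  rewrite (_ : [set _ | _] = B `&` [set t | s n t != 0]).
    by apply: le_measure; rewrite ?inE//; exact: measurableI.
  apply/seteqP; split=> t /=.
    by case: ifPn => [/set_mem//|]; rewrite eqxx.
  by move=> [Bt]; rewrite mem_set.
Qed.

Definition chi_scalar (B : set T) (g : T -> K) : T -> K :=
  fun t => if t \in B then g t else 0.

Lemma part_chi_scalar B b (g : T -> K) :
  scalar_part b \o chi_scalar B g = (scalar_part b \o g) \_ B.
Proof.
apply/funext => t; rewrite /chi_scalar patchE/=.
by case: ifP => // _; rewrite scalar_part0.
Qed.

Lemma integrable_scalarP (g : T -> K) : integrable_scalar mu g <->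
  forall b, mu.-integrable setT (EFin \o (@scalar_part R k b \o g)).
Proof.
by split=> [[h1 h2] []//|h]; split; [exact: (h true)|exact: (h false)].
Qed.

Lemma integrable_chi_scalar B (g : T -> K) : measurable B ->
  integrable_scalar mu g -> integrable_scalar mu (chi_scalar B g).
Proof.
move=> mB /integrable_scalarP ig; apply/integrable_scalarP => b.
rewrite part_chi_scalar -restrict_EFin; apply/(integrable_mkcond _ mB).
exact: integrableS (ig b).
Qed.

Lemma has_integralP A (f : T -> K) (c : K) : has_integral mu A f c <->
  exists g, [/\ integrable_scalar mu g, {ae mu, forall t, f t = g t} &
    forall b, scalar_part b c = \int[mu]_(t in A) scalar_part b (g t)].
Proof.
split=> [[g [ig fg h1 h2]]|[g [ig fg h]]]; exists g.
  by split=> // -[].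
by split; [| |exact: (h true)|exact: (h false)].
Qed.

Lemma ae_chi_mul B (F : T -> X) (g : T -> K) (x' : {linear X -> K^o}) :
  {ae mu, forall t, x' (F t) = g t} ->
  {ae mu, forall t, x' (chi_mul B F t) = chi_scalar B g t}.
Proof.
apply: filterS => t xg; rewrite chi_mulE /chi_scalar.
by case: ifP => // _; rewrite linear0.
Qed.

Lemma is_pettis_integral_chi_mul A B (F : T -> X) x :
  measurable A -> measurable B ->
  is_pettis_integral mu (A `&` B) F x ->
  is_pettis_integral mu A (chi_mul B F) x.
Proof.
move=> mA mB h x' cx'; have /has_integralP[g [ig fg xg]] := h x' cx'.
apply/has_integralP; exists (chi_scalar B g); split.
- exact: integrable_chi_scalar.
- exact: ae_chi_mul.
- move=> b; rewrite xg Rintegral_mkcondr.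
  by rewrite -[in LHS]part_chi_scalar.
Qed.

Lemma pettis_integrable_chi_mul B (F : T -> X) : measurable B ->
  pettis_integrable mu F -> pettis_integrable mu (chi_mul B F).
Proof.
move=> mB [wF lF pF]; split; first exact: weakly_measurable_chi_mul.
- move=> x' cx'; have [g ig fg] := lF x' cx'.
  by exists (chi_scalar B g); [exact: integrable_chi_scalar|exact: ae_chi_mul].
- move=> A mA; have [x hx] := pF _ (measurableI _ _ mA mB).
  by exists x; exact: is_pettis_integral_chi_mul.
Qed.

Lemma pettis_measureP B (F : T -> X) : measurable B ->
  pettis_integrable mu (chi_mul B F) ->
  is_pettis_integral mu B (chi_mul B F) (pettis_measure mu F B).
Proof.
move=> mB [_ _ /(_ _ mB)[x hx]].
by rewrite /pettis_measure /pettis_integral; case: xgetP => [y _//|/(_ x)].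
Qed.

End Restriction.

(** * The Pettis measure *)

Section PettisMeasure.
Context (R : realType) (k : RorC) (d : measure_display) (T : measurableType d).
Variable mu : {measure set T -> \bar R}.
Local Notation K := (scalar_field R k).
Context (X : completeNormedModType K).
Variable F : T -> X.
Hypothesis wF : weakly_measurable mu F.
Local Notation nu := (pettis_measure mu F).

(** [nu A] is a genuine integral and not the junk value. This holds for sets of
  finite measure when [F] is locally Pettis integrable and for all measurable
  sets when [F] is Pettis integrable, so that both cases are treated at once. *)
Definition pettis_on (A : set T) :=
  measurable A /\ is_pettis_integral mu A (chi_mul A F) (nu A).

(** One version of [x' \o F] computes the integrals over all sets, whereas the
  definition of the Pettis integral provides a function for each set. *)
Lemma pettis_on_version (x' : {linear X -> K^o}) h E A b : continuous x' ->
  sigma_finite_version mu (x' \o F) h E -> pettis_on A ->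
  mu.-integrable A (EFin \o (scalar_part b \o h)) /\
  scalar_part b (x' (nu A)) = \int[mu]_(t in A) scalar_part b (h t).
Proof.
move=> cx' ver [mA /(_ x' cx')/has_integralP[g [/integrable_scalarP ig fg ->]]].
have [||||? ->] := @ae_eq_integrable _ _ _ mu A
  (scalar_part b \o g) (scalar_part b \o h).
- exact: mA.
- exact: measurable_funS (version_meas ver b).
- exact: integrableS (ig b).
- have := version_ae ver; apply: filterS2 fg => t /= h1 h2 At.
  by rewrite -h2 -h1 chi_mulE mem_set.
- by [].
Qed.

Lemma pettis_measureU A B : A `&` B = set0 -> pettis_on A -> pettis_on B ->
  pettis_on (A `|` B) -> nu (A `|` B) = nu A + nu B.
Proof.
move=> AB pA pB pU; apply: dual_separates => x' cx'.
have [h [E ver]] := strongly_measurable_version (wF cx').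
rewrite linearD scalar_reD.
have [iU /= e] := pettis_on_version true cx' ver pU; rewrite [LHS]e.
rewrite Rintegral_setU//; [|exact: pA.1|exact: pB.1|exact/disj_set2P].
have [_ /= e1] := pettis_on_version true cx' ver pA.
have [_ /= e2] := pettis_on_version true cx' ver pB.
by rewrite -e1 -e2.
Qed.

(** The Orlicz-Pettis theorem applied to the values of [nu] on the unions of the
  subfamilies of a disjoint sequence. *)
Lemma pettis_measure_tail (B : nat -> set T) : trivIset setT B ->
  (forall n, measurable (B n)) ->
  (forall A, measurable A -> A `<=` \bigcup_n B n -> pettis_on A) ->
  forall e, 0 < e -> exists n, forall S, S `<=` [set i | (n <= i)%N] ->
    real_norm (nu (\bigcup_(i in S) B i)) <= e.
Proof.
move=> tB mB pB.
have pS S : pettis_on (\bigcup_(i in S) B i).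
  by apply: pB => [|t [n _ Bt]]; [exact: bigcup_measurable|exists n].
apply: (@orlicz_pettis R (realified X) (@real_norm R k X)
  (@real_normD _ _ _) (@real_normZ _ _ _) (fun S => nu (\bigcup_(i in S) B i))).
- move=> S S' SS'; rewrite bigcup_setU; apply: pettis_measureU => //.
    apply/seteqP; split=> t //= [[i Si Bi] [j Sj Bj]].
    have ij : i = j by apply: (tB i j) => //; exists t.
    have : (S `&` S') i by split=> //; rewrite ij.
    by rewrite SS'.
  by rewrite -bigcup_setU.
- move=> u uN e e0; have [x' [cx' xu]] := complexify uN.
  have [h [E ver]] := strongly_measurable_version (wF cx').
  have [iU _] := pettis_on_version true cx' ver (pS setT).
  have mU : measurable (\bigcup_n B n) by exact: bigcup_measurable.
  have [|||n hn] := integral_tail mU iU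
    (H := fun n => \bigcup_(i in `I_n) B i) _ _ _ e0.
  + by move=> n; exact: bigcup_measurable.
  + by move=> n m nm; apply: bigcup_subset => i /= /leq_trans; apply.
  + by move=> t [n _ Bt] []; exists n.+1 => //; exists n => /=.
  exists n => S Sn; rewrite -xu.
  have [_ /= ->] := pettis_on_version true cx' ver (pS S).
  apply: hn; first exact: bigcup_measurable.
  move=> t [i Si Bi]; split; first by exists i.
  move=> [j /= jn Bj]; have ij : i = j by apply: (tB i j) => //; exists t.
  by have := Sn _ Si; rewrite /= ij leqNgt jn.
Qed.

(** Otherwise, greedily adding to a set of finite measure a disjoint set on
  which the norm of [nu] exceeds [e] would produce a disjoint sequence along
  which [nu] does not tend to 0. *)
Lemma strongly_additive_exhaustion : strongly_additive mu nu ->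
  forall e, 0 < e -> exists2 B, finite_meas mu B & forall C, finite_meas mu C ->
    C `&` B = set0 -> real_norm (nu C) <= e.
Proof.
move=> sa e e0; apply: contrapT => noB.
have /choice[f hf] : forall B, exists C, finite_meas mu B ->
    [/\ finite_meas mu C, C `&` B = set0 & e < real_norm (nu C)].
  move=> B; have [fB|nB] := pselect (finite_meas mu B); last by exists set0.
  apply: contrapT => noC; apply: noB; exists B => // C fC CB.
  by rewrite leNgt; apply/negP => eC; apply: noC; exists C.
pose G := fix G n := if n is m.+1 then G m `|` f (G m) else set0.
have fG n : finite_meas mu (G n).
  elim: n => [|n IH] /=; first exact: finite_meas0.
  by apply: finite_measU => //; have [] := hf _ IH.
have Gmono n m : (n < m)%N -> f (G n) `<=` G m.
  elim: m => // m IH; rewrite ltnS leq_eqVlt => /orP[/eqP -> t ?|/IH h t /h].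
    by right.
  by left.
have dis n m : (n < m)%N -> f (G n) `&` f (G m) = set0.
  move=> /Gmono h; have [_ + _] := hf _ (fG m); move=> /seteqP[d0 _].
  by apply/seteqP; split=> t // [/h ? ?]; apply: d0.
have : nu (f (G n)) @[n --> \oo] --> (0 : X).
  apply: sa => [n|]; first by have [] := hf _ (fG n).
  apply/trivIsetP => i j _ _; rewrite neq_ltn => /orP[/dis //|/dis].
  by rewrite setIC.
move=> /cvg_real_norm/(_ e e0)[n /(_ n (leqnn n))].
rewrite sub0r /real_norm normrN leNgt.
by have [_ _ ->] := hf _ (fG n).
Qed.

Lemma pettis_integrable_locally : pettis_integrable mu F -> locally_pettis mu F.
Proof.
by move=> pF; split=> // B [mB _]; exact: pettis_integrable_chi_mul.
Qed.

Lemma pettis_integrable_on A : pettis_integrable mu F -> measurable A ->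
  pettis_on A.
Proof.
move=> pF mA; split=> //; apply: pettis_measureP => //.
exact: pettis_integrable_chi_mul.
Qed.

Lemma locally_pettis_on A : locally_pettis mu F -> finite_meas mu A ->
  pettis_on A.
Proof.
move=> [_ lF] fA; have mA := fA.1; split=> //.
by apply: pettis_measureP => //; exact: lF.
Qed.

Lemma pettis_integrable_strongly_additive :
  pettis_integrable mu F -> strongly_additive mu nu.
Proof.
move=> pF B fB tB; apply/cvg_real_norm => e e0.
have [|A mA _|n hn] := pettis_measure_tail tB _ _ e0.
- by move=> n; exact: (fB n).1.
- exact: pettis_integrable_on.
exists n => m nm; rewrite sub0r /real_norm normrN.
by have := hn [set m]; rewrite bigcup_set1; apply => _ ->.
Qed.

Lemma locally_pettis_vector_measure :
  locally_pettis mu F -> vector_measure mu nu.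
Proof.
move=> lF B fB tB fU.
have pU A : measurable A -> A `<=` \bigcup_n B n -> pettis_on A.
  by move=> mA AU; apply: locally_pettis_on => //; exact: finite_measS fU mA AU.
have mB n : measurable (B n) := (fB n).1.
apply/cvg_real_norm => e e0.
have [n hn] := pettis_measure_tail tB mB pU e0.
exists n => m nm.
suff -> : nu (\bigcup_n B n) - \sum_(0 <= i < m) nu (B i) =
    nu (\bigcup_(i in [set i | (m <= i)%N]) B i).
  by apply: hn => i /=; exact: leq_trans.
elim: m {nm} => [|m IH]; first rewrite big_nil subr0.
  by congr (nu (\bigcup_(i in _) _)); apply/seteqP.
rewrite big_nat_recr//= opprD addrA IH.
have mE : [set i | (m <= i)%N] = [set m] `|` [set i | (m < i)%N].
  apply/seteqP; split=> i /=.
    by rewrite leq_eqVlt => /orP[/eqP ->|?]; [left|right].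
  by case=> [->//|/ltnW].
have pS S : pettis_on (\bigcup_(i in S) B i).
  by apply: pU => [|t [j _ Bt]]; [exact: bigcup_measurable|exists j].
rewrite mE bigcup_setU pettis_measureU//; last by rewrite -bigcup_setU.
  by rewrite bigcup_set1 addrAC subrr add0r.
apply/seteqP; split=> t //= [[i /= -> Bi] [j /= mj Bj]].
have ij : m = j by apply: (tB m j) => //; exists t.
by rewrite ij ltnn in mj.
Qed.

(** The Pettis integral of [F] over [A] is the limit of [nu] along sets
  [A `&` G n] that exhaust [nu]; it is a limit of integrals for every
  functional because each functional only sees a countable union of sets of
  finite measure. *)
Lemma strongly_additive_pettis_integrable :
  locally_pettis mu F -> strongly_additive mu nu -> pettis_integrable mu F.
Proof.
move=> lF sa.
have pon A : finite_meas mu A -> pettis_on A by exact: locally_pettis_on.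
have exh := strongly_additive_exhaustion sa.
have integrable_h (x' : {linear X -> K^o}) h E : continuous x' ->
    sigma_finite_version mu (x' \o F) h E ->
    forall b, mu.-integrable setT (EFin \o (scalar_part b \o h)).
  move=> cx' ver b; have [C C0 hC] := continuous_linear_bound cx'.
  apply: (integrable_of_tail (E := E)).
  - exact: version_meas ver b.
  - exact: version_fin ver.
  - exact: version_homo ver.
  - by move=> t /(version_supp ver)/= ->; rewrite scalar_part0.
  - by move=> B fB; have [] := pettis_on_version b cx' ver (pon _ fB).
  - have [B fB hB] := exh 1 ltr01; exists B, C; split=> // D fD DB.
    have [_ /= <-] := pettis_on_version b cx' ver (pon _ fD).
    rewrite (le_trans (norm_scalar_part _ _))// (le_trans (hC _))//.
    by apply: ler_piMr; [exact: ltW|exact: hB].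
split=> //.
  move=> x' cx'; have [h [E ver]] := strongly_measurable_version (wF cx').
  exists h; last exact: version_ae ver.
  by apply/integrable_scalarP; exact: integrable_h ver.
have /choice[B hB] : forall n : nat, exists B, finite_meas mu B /\
    forall C, finite_meas mu C -> C `&` B = set0 ->
      real_norm (nu C) <= n.+1%:R^-1.
  move=> n; have [|B fB hB] := exh n.+1%:R^-1; first by rewrite invr_gt0.
  by exists B.
pose G := unions_upto B.
have fG n : finite_meas mu (G n).
  by apply: finite_meas_unions_upto => m; have [] := hB m.
have Gmono := @unions_upto_homo _ T B.
have hG n C : finite_meas mu C -> C `&` G n = set0 ->
    real_norm (nu C) <= n.+1%:R^-1.
  move=> fC /seteqP[CG _]; apply: (hB n).2 => //.
  apply/seteqP; split=> // t [Ct Bt]; apply: CG; split=> //.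
  exact: sub_unions_upto.
move=> A mA.
have fAG n : finite_meas mu (A `&` G n).
  by apply: (finite_measS (fG n)) => //; exact: measurableI mA (fG n).1.
have fAD n D : finite_meas mu D -> finite_meas mu (A `&` (D `\` G n)).
  move=> fD; apply: (finite_measS fD); last by move=> t [_ []].
  exact: measurableI mA (measurableD fD.1 (fG n).1).
(* The difference is the value of [nu] on a subset of [D `\` G n]. *)
have step n D : finite_meas mu D -> G n `<=` D ->
    real_norm (nu (A `&` G n) - nu (A `&` D)) <= n.+1%:R^-1.
  move=> fD GD.
  have eD : A `&` D = (A `&` G n) `|` (A `&` (D `\` G n)).
    by rewrite -setIUr setDUK.
  rewrite [in X in _ - X]eD pettis_measureU; first last.
  - rewrite -eD; apply: pon; apply: (finite_measS fD); last by move=> t [].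
    exact: measurableI mA fD.1.
  - exact/pon/fAD.
  - exact/pon/fAG.
  - by apply/seteqP; split=> t // [[_ ?] [_ []]].
  rewrite opprD addrA subrr sub0r /real_norm normrN.
  apply: hG; first exact: fAD.
  by apply/seteqP; split=> t // [[_ [_ ?]]].
have small (e : R) : 0 < e -> exists n, forall m, (n <= m)%N -> m.+1%:R^-1 <= e.
  move=> e0; have [n _ hn] := near_infty_natSinv_lt (PosNum e0).
  by exists n => m nm; apply/ltW/hn.
have [e e0|x hx] := @cauchy_real_norm _ _ X (fun n => nu (A `&` G n)).
  have [n hn] := small e e0; exists n => m nm.
  exact: le_trans (step n _ (fG m) (Gmono _ _ nm)) (hn _ _).
exists x => x' cx'.
have [h [E ver]] := strongly_measurable_version (wF cx').
have ih := integrable_h _ _ _ cx' ver.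
apply/has_integralP; exists h; split.
- exact/integrable_scalarP.
- exact: version_ae ver.
move=> b; have [C C0 hC] := continuous_linear_bound cx'.
(* [G n] carries [nu] up to [1 / (n + 1)] and depends on no functional; the
   sets [E n] carry [x' \o F] but depend on [x']. Their union serves both
   purposes. *)
pose H n := G n `|` E n.
have fH n : finite_meas mu (H n).
  by apply: finite_measU => //; exact: version_fin ver n.
have iA : mu.-integrable A (EFin \o (scalar_part b \o h)).
  exact: integrableS (ih b).
have Hmono : {homo H : n m / (n <= m)%N >-> n `<=` m}.
  move=> n m nm; apply: setUSS; first exact: Gmono.
  exact: version_homo ver _ _ nm.
have tail := integral_tail mA iA (fun n => (fH n).1) Hmono.
apply/eqP; rewrite -subr_eq0 -normr_le0.
apply/ler_addgt0Pr => e e0; rewrite add0r.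
have e3 : 0 < e / 3 by rewrite divr_gt0.
have eC : 0 < e / 3 / C by rewrite divr_gt0.
have [|n1 h1] := tail _ _ e3.
  move=> t _ Ht; rewrite /= (version_supp ver) ?scalar_part0// => -[n _ Et].
  by apply: Ht; exists n => //; right.
have [n2 h2] := small _ eC.
have [n3 h3] := (cvg_real_norm _ _).2 hx _ eC.
pose n := maxn n1 (maxn n2 n3).
have nn1 : (n1 <= n)%N by exact: leq_maxl.
have nn2 : (n2 <= n)%N by rewrite /n leq_max leq_maxl orbT.
have nn3 : (n3 <= n)%N by rewrite /n !leq_max leqnn !orbT.
have fAH : finite_meas mu (A `&` H n).
  by apply: (finite_measS (fH n)) => //; exact: measurableI mA (fH n).1.
have [_ /= eAH] := pettis_on_version b cx' ver (pon _ fAH).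
have part_le y : real_norm y <= e / 3 / C -> `|scalar_part b (x' y)| <= e / 3.
  move=> ye; rewrite (le_trans (norm_scalar_part _ _))// (le_trans (hC _))//.
  by rewrite mulrC -ler_pdivlMr.
have a1 := part_le _ (h3 _ nn3).
have a2 := part_le _ (le_trans (step n _ (fH n) (@subsetUl _ _ _)) (h2 _ nn2)).
have a3 : `|scalar_part b (x' (nu (A `&` H n))) -
    \int[mu]_(t in A) scalar_part b (h t)| <= e / 3.
  rewrite distrC eAH -Rintegral_setD//; last exact: fAH.1.
  apply: h1; first exact: measurableD mA fAH.1.
  move=> t [At AHt]; split=> // Ht; apply: AHt; split=> //.
  exact: Hmono nn1 _ Ht.
rewrite linearB scalar_partB in a1; rewrite linearB scalar_partB in a2.
move: a1 a2 a3; rewrite !ler_norml => /andP[? ?] /andP[? ?] /andP[? ?].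
by apply/andP; split; lra.
Qed.

End PettisMeasure.

(** * The characterization of Pettis integrability *)

Theorem corollary4p4 (R : realType) (k : RorC) (d : measure_display)
    (T : measurableType d) (mu : {measure set T -> \bar R})
    (X : completeNormedModType (scalar_field R k)) (F : T -> X) :
  locally_determined mu -> weakly_measurable mu F ->
  (locally_pettis mu F -> vector_measure mu (pettis_measure mu F)) /\
  (pettis_integrable mu F <->
     locally_pettis mu F /\ strongly_additive mu (pettis_measure mu F)).
Proof.
move=> _ wF; split; first exact: locally_pettis_vector_measure.
split=> [pF|[]]; last exact: strongly_additive_pettis_integrable.
split; first exact: pettis_integrable_locally.
exact: pettis_integrable_strongly_additive.
Qed.
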